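(* For every $u\in(\xi+1/H_\xi,\,E)$, the ratio $\widetilde{\underline{t}}_{u+n}/(u+n)$ is independent of $n>-\xi$; that is, for every real $n>-\xi$, $$\frac{\widetilde{\underline{t}}_{u+n}}{u+n}=\frac{\widetilde{t}_u}{u}.$$
   Context: A game $(a(x),F(x))$ consists of a distribution function $F$ on an interval $I\subseteq(-\infty,\infty)$ with $\int_I dF=1$ (Lebesgue–Stieltjes integral, $dF=d(F(x))$) and a measurable profit function $a:I\to\mathbb{R}$ that is not a.e. constant with respect to $F$. Put $E=\int_I a(x)\,dF$ (possibly $+\infty$), $H=\int_I \frac{1}{a(x)}\,dF$, $\xi=\operatorname{ess\,inf}_{x\in I}a(x)$ (with respect to $F$), and $H_\xi=\int_I\frac{1}{a(x)-\xi}\,dF$, with the convention $H_\xi=\infty$ and $1/H_\xi=0$ if $\int_{a(x)=\xi}dF>0$ (and $1/\infty=0$ generally). Standing assumption: $\xi>0$. One has $\xi\le \xi+1/H_\xi<1/H<E$. For $u\in(\xi+1/H_\xi,E)$, the pre-optimal proportion $\widetilde{t}_u$ is the unique $t\in(0,u/(u-\xi))$ satisfying $\int_I\frac{a(x)-u}{a(x)t-ut+u}\,dF=0$ (existence and uniqueness are known). For $u\in(\xi+1/H_\xi,E)$ and $t\in(0,u/(u-\xi))$, the pre-growth rate is $\widetilde{G}_u(t)=\exp\left(\int_I\log\left(\frac{a(x)t}{u}-t+1\right)dF\right)$. Standing assumption: these pre-growth rates are finite (equivalently $\int_{a(x)>1}\log a(x)\,dF<+\infty$). For a real number $n>-\xi$,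 the game with parallel translated profit is $(a(x)+n,F(x))$; underlined symbols denote the same quantities for this game: $\underline{a}(x)=a(x)+n$, $\underline{E}=E+n$, $\underline{H}=\int_I\frac{1}{a(x)+n}\,dF$, $\underline{\xi}=\xi+n$, $\underline{H}_{\underline{\xi}}=\int_I\frac{1}{\underline{a}(x)-\underline{\xi}}\,dF=H_\xi$. Thus $\widetilde{\underline{t}}_{u+n}$ is the pre-optimal proportion of the game $(a(x)+n,F(x))$ at price $u+n$, i.e. the unique $t\in(0,(u+n)/(u-\xi))$ with $\int_I\frac{a(x)-u}{(a(x)-u)t+u+n}\,dF=0$. *)

(* Defs.v *)
From mathcomp Require Import all_boot all_order all_algebra.
From mathcomp Require Import all_classical all_reals all_analysis.
From mathcomp Require Import measurable_realfun ess_sup_inf.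

Set Implicit Arguments.
Unset Strict Implicit.
Unset Printing Implicit Defensive.

Import Order.TTheory GRing.Theory Num.Theory.
Import numFieldNormedType.Exports.

Local Open Scope classical_set_scope.
Local Open Scope ring_scope.

(* The real line with the sigma-algebra of the F-measurable sets, i.e. the
   completion of the Borel sets for the Lebesgue-Stieltjes measure of F. As its
   carrier is convertible to R, on which the Borel sets are the default, the
   structure has to be given explicitly to [measurable_fun]. *)
Definition stieltjes_type (R : realType) (F : cumulative R R) :
    measurableType _ :=
  caratheodory_type (mu_ext (wlength F)).

Definition stieltjes (R : realType) (F : cumulative R R) :
    {measure set (stieltjes_type F) -> \bar R} :=
  completed_lebesgue_stieltjes_measure F.

Lemma measurable_stieltjes_itv (R : realType) (F : cumulative R R)
    (I : interval R) : @measurable _ (stieltjes_type F) [set` I].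
Proof. apply: sub_caratheodory; exact: measurable_itv. Qed.

(* F is taken right-continuous and extended from I to the whole line: its
   values outside I are irrelevant because all the integrals are over I. A jump
   of F at a closed left endpoint of I is an atom of dF. *)
Record game (R : realType) := Game {
  domain : interval R ;
  distr : cumulative R R ;
  profit : R -> R ;
  game_mass1 : stieltjes distr [set` domain] = 1%E ;
  measurable_profit :
    @measurable_fun _ _ (stieltjes_type distr) R [set` domain] profit ;
  profit_not_ae_cst : ~ exists c : R,
    {ae stieltjes distr, forall x, [set` domain] x -> profit x = c} }.

Section game_quantities.
Context {R : realType}.
Implicit Types (G : game R) (u t : R).

Definition game_integral G (f : R -> R) : \bar R :=
  (\int[stieltjes (distr G)]_(x in [set` domain G]) (f x)%:E)%E.

Definition expected_profit G : \bar R := game_integral G (profit G).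

(* The essential infimum of the profit on I; the game has mass 1, so it is
   never +oo. If it is -oo then xi G = 0, hence 0 < xi G holds exactly when the
   essential infimum is positive and finite. *)
Definition xi G : R :=
  fine (ess_inf (mrestr (stieltjes (distr G))
                        (measurable_stieltjes_itv (distr G) (domain G)))
                (fun x => (profit G x)%:E)).

(* In R the inverse of 0 is 0, so that the value +oo in case of an atom of the
   profit at xi has to be given explicitly. *)
Definition H_xi G : \bar R :=
  if (0 < stieltjes (distr G) ([set` domain G] `&` [set x | profit G x = xi G]))%E
  then +oo%E
  else game_integral G (fun x => (profit G x - xi G)^-1).

(* The inverse of extended reals satisfies (+oo)^-1 = 0. *)
Definition admissible_price G u : Prop :=
  ((xi G)%:E + (H_xi G)^-1 < u%:E < expected_profit G)%E.

Definition admissible_proportion G u t : Prop := 0 < t < u / (u - xi G).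

Definition pre_growth_rate G u t : \bar R :=
  expeR (game_integral G (fun x => ln (profit G x * t / u - t + 1))).

Definition finite_pre_growth G : Prop :=
  forall u t, admissible_price G u -> admissible_proportion G u t ->
    pre_growth_rate G u t \is a fin_num.

(* The integral is extended-real valued and equals -oo when the positive and
   the negative parts both have infinite integrals, so that its being 0 entails
   integrability. *)
Definition is_pre_optimal G u t : Prop :=
  admissible_proportion G u t /\
  game_integral G
    (fun x => (profit G x - u) / (profit G x * t - u * t + u)) = 0%E.

(* When 0 < xi G and u is admissible, exactly one t satisfies
   [is_pre_optimal G u t], so [get] returns that t. *)
Definition pre_optimal G u : R := [get t | is_pre_optimal G u t].

End game_quantities.

Section translate.
Context {R : realType} (G : game R) (n : R).

Let profit_n : R -> R := fun x => profit G x + n.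

Let measurable_profit_n :
  @measurable_fun _ _ (stieltjes_type (distr G)) R [set` domain G] profit_n.
Proof. apply: measurable_funD; [exact: measurable_profit|exact: measurable_cst]. Qed.

Let profit_n_not_ae_cst : ~ exists c : R,
  {ae stieltjes (distr G), forall x, [set` domain G] x -> profit_n x = c}.
Proof.
move=> [c cP]; apply: (@profit_not_ae_cst _ G); exists (c - n).
have ae_filter := ae_filter_ringOfSetsType (stieltjes (distr G)).
by apply: (@filterS _ _ ae_filter) cP => x /[apply] <-; rewrite addrK.
Qed.

Definition translate : game R :=
  Game (game_mass1 G) measurable_profit_n profit_n_not_ae_cst.

End translate.

(* Main.v *)
Require Import Defs.
From mathcomp Require Import all_boot all_order all_algebra.
From mathcomp Require Import all_classical all_reals all_analysis.
From mathcomp Require Import measurable_realfun ess_sup_inf ring lra.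

(** Write [b = a - u] for the excess of the profit over the price. Translating
    the profit and the price by [n] leaves [b] unchanged, so the equation for
    the pre-optimal proportion [s] of the translated game involves
    [b / (b * s + (u + n))]. The substitution [s = (u + n) / u * t] turns this
    integrand into [u / (u + n)] times the integrand [b / (b * t + u)] of the
    original game. Hence [t |-> (u + n) / u * t] maps the solutions for the
    original game onto those for the translated one; the admissible proportions
    correspond as well, because the essential infimum is translated by [n] too
    and [u - xi] is unchanged ([is_pre_optimal_translate]).

    To pass from the two solution sets to the two chosen solutions, one needs
    that each set has at most one element ([is_pre_optimal_unique]). Since
    [b / (b * t + u)] is nonincreasing in [t] wherever the denominator is
    positive, two solutions give comparable integrands with the same integral,
    which therefore agree almost everywhere; this forces [b = 0] almost
    everywhere, and the profit is not almost everywhere constant. The argument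
    needs [xi < u], which follows from the admissibility of the price because
    [H_xi >= 0], and it needs both integrands to be integrable, which follows
    from their integrals being finite.

    The correspondence settles the empty case too: when one game has no
    solution, neither has the other, and both proportions are the default value
    [0]. *)

Set Implicit Arguments.
Unset Strict Implicit.
Unset Printing Implicit Defensive.

Import Order.TTheory GRing.Theory Num.Theory.
Import numFieldNormedType.Exports.

Local Open Scope classical_set_scope.
Local Open Scope ring_scope.

(** * Measure and integration *)

(** The inverse is not continuous at [0]; writing it through the power
    [(x ^+ 2) `^ (-1)] reduces its measurability to that of real powers. *)
Lemma measurable_invr (R : realType) :
  measurable_fun [set: R] (fun x : R => x^-1).
Proof.
have -> : (fun x : R => x^-1) = (fun x => x * (x ^+ 2) `^ (-1)).
  apply/funext => x; rewrite powR_inv1 ?sqr_ge0//.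
  have [->|x0] := eqVneq x 0; first by rewrite invr0 mul0r.
  by rewrite expr2 invfM mulrA divff// mul1r.
apply: measurable_funM => //.
apply: (measurableT_comp (@measurable_powR R (-1))).
exact: measurable_funX.
Qed.

Section integral.
Context d (T : measurableType d) (R : realType).
Variables (mu : {measure set T -> \bar R}) (D : set T).
Hypothesis mD : measurable D.
Implicit Types f g : T -> R.

Lemma ae_restr (P : T -> Prop) :
  {ae mrestr mu mD, forall x, P x} -> {ae mu, forall x, D x -> P x}.
Proof.
move=> [A [mA A0 PA]]; exists (A `&` D); split => //; first exact: measurableI.
by move=> x /= /not_implyP[Dx nPx]; split => //; exact: PA.
Qed.

Lemma ess_infDr (f : T -> \bar R) (r : R) :
  ess_inf mu (fun x => f x + r%:E)%E = (ess_inf mu f + r%:E)%E.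
Proof.
apply/eqP; rewrite eq_le; apply/andP; split.
  rewrite -leeBlDr//; apply/ess_infP.
  by apply: filterS (ess_inf_le mu (fun x => f x + r%:E)%E) => x; rewrite leeBlDr.
by apply/ess_infP; apply: filterS (ess_inf_le mu f) => x; rewrite leeD2rE.
Qed.

(** An integral is the difference of the integrals of the positive and of the
    negative part, and [+oo - +oo] is [-oo], so that a finite value leaves only
    the case where both parts have finite integrals. *)
Lemma integral_fin_num_integrable (f : T -> \bar R) : measurable_fun D f ->
  (\int[mu]_(x in D) f x)%E \is a fin_num -> mu.-integrable D f.
Proof.
move=> mf; rewrite integralE => fin; apply/integrableP; split => //.
have := fin; rewrite fin_numB => /andP[finp finn].
under eq_integral do rewrite -/((abse \o f) _) fune_abse.
rewrite ge0_integralD//; first by rewrite lte_add_pinfty// -ge0_fin_numE// integral_ge0.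
- exact: measurable_funepos.
- exact: measurable_funeneg.
Qed.

Lemma integral_scale_eq0 f (c : R) : measurable_fun D f ->
  (\int[mu]_(x in D) (f x)%:E = 0 -> \int[mu]_(x in D) (c * f x)%:E = 0)%E.
Proof.
move=> mf f0.
under eq_integral do rewrite EFinM.
rewrite integralZl ?f0 ?mule0//.
by apply: integral_fin_num_integrable; [exact/measurable_EFinP|rewrite f0].
Qed.

Lemma integral_ae_ge0E f : measurable_fun D f ->
  {ae mu, forall x, D x -> 0 <= f x} ->
  (\int[mu]_(x in D) (f x)%:E = \int[mu]_(x in D) `|(f x)%:E|)%E.
Proof.
move=> mf f0; apply: ae_eq_integral => //.
- exact/measurable_EFinP.
- by apply: measurableT_comp => //; exact/measurable_EFinP.
- by apply: filterS f0 => x f0 Dx; rewrite /= ger0_norm// f0.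
Qed.

(** [g - f] is almost everywhere its own absolute value and integrates to [0]. *)
Lemma ae_le_integral_eq0 f g : measurable_fun D f -> measurable_fun D g ->
  (\int[mu]_(x in D) (f x)%:E = 0)%E -> (\int[mu]_(x in D) (g x)%:E = 0)%E ->
  {ae mu, forall x, D x -> f x <= g x} -> {ae mu, forall x, D x -> f x = g x}.
Proof.
move=> mf mg f0 g0 fg.
have mh : measurable_fun D (fun x => g x - f x) by exact: measurable_funB.
have : (\int[mu]_(x in D) `|(g x - f x)%:E| = 0)%E.
  rewrite -integral_ae_ge0E//; last first.
    by apply: filterS fg => x fg Dx; rewrite subr_ge0 fg.
  under eq_integral do rewrite EFinB.
  rewrite integralB ?f0 ?g0 ?sube0//.
    by apply: integral_fin_num_integrable; [exact/measurable_EFinP|rewrite g0].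
  by apply: integral_fin_num_integrable; [exact/measurable_EFinP|rewrite f0].
move/ae_eq_integral_abs => /(_ mD) h0.
have {}h0 := h0 ((measurable_EFinP _ _).2 mh).
apply: filterS h0 => x h0 Dx; apply/esym/eqP; rewrite -subr_eq0.
by have /= [->] := h0 Dx.
Qed.

End integral.

(** * Essential infimum and admissible prices *)

Section game.
Context (R : realType).
Implicit Types (G : game R) (u t n : R).

#[local] Instance ae_stieltjes_filter (F : cumulative R R) :
  Filter (nbhs (almost_everywhere (stieltjes F))) :=
  ae_filter_ringOfSetsType (stieltjes F).

(** If the essential infimum were infinite, [fine] would give [xi G = 0]. *)
Lemma ess_inf_profitE G : 0 < xi G ->
  ess_inf (mrestr (stieltjes (distr G))
    (measurable_stieltjes_itv (distr G) (domain G)))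
    (fun x => (profit G x)%:E) = (xi G)%:E.
Proof. by rewrite /xi; case: ess_inf => [r||] //=; rewrite ltxx. Qed.

Lemma xi_le_profit G : 0 < xi G ->
  {ae stieltjes (distr G), forall x, [set` domain G] x -> xi G <= profit G x}.
Proof.
move=> xi0; apply: (@ae_restr _ _ _ _ _ (measurable_stieltjes_itv _ _)).
have := @ess_inf_le _ _ _ (mrestr (stieltjes (distr G))
    (measurable_stieltjes_itv (distr G) (domain G))) (fun x => (profit G x)%:E).
by rewrite ess_inf_profitE//; apply: filterS => x; rewrite lee_fin.
Qed.

Lemma xi_translate G n : 0 < xi G -> xi (translate G n) = xi G + n.
Proof.
move=> xi0; rewrite {1}/xi /=.
have -> : (fun x => (profit G x + n)%:E) = (fun x => (profit G x)%:E + n%:E)%E by [].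
by rewrite ess_infDr ess_inf_profitE.
Qed.

Lemma H_xi_ge0 G : 0 < xi G -> (0 <= H_xi G)%E.
Proof.
move=> xi0; rewrite /H_xi; case: ifP => // _.
have mD := measurable_stieltjes_itv (distr G) (domain G).
have mf : @measurable_fun _ _ (stieltjes_type (distr G)) R [set` domain G]
    (fun x => (profit G x - xi G)^-1).
  apply: (measurableT_comp (@measurable_invr R)).
  by apply: measurable_funB; [exact: measurable_profit|exact: measurable_cst].
rewrite /game_integral (integral_ae_ge0E mD mf); first exact: integral_ge0.
by apply: filterS (xi_le_profit xi0) => x le Dx; rewrite invr_ge0 subr_ge0 le.
Qed.

Lemma xi_lt_price G u : 0 < xi G -> admissible_price G u -> xi G < u.
Proof.
move=> xi0 /andP[lt_u _]; rewrite -lte_fin; apply: le_lt_trans lt_u.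
by rewrite leeDl// inve_ge0 H_xi_ge0.
Qed.

(** * Pre-optimal proportions *)

(** The integrand in [is_pre_optimal]. *)
Definition excess_ratio G u t x := (profit G x - u) / (profit G x * t - u * t + u).

Lemma measurable_excess_ratio G u t :
  @measurable_fun _ _ (stieltjes_type (distr G)) R [set` domain G]
    (excess_ratio G u t).
Proof.
have mp := @measurable_profit _ G.
apply: measurable_funM.
  by apply: measurable_funB; [exact: mp|exact: measurable_cst].
apply: (measurableT_comp (@measurable_invr R)).
apply: measurable_funD; last exact: measurable_cst.
apply: measurable_funB; last exact: measurable_cst.
by apply: measurable_funM; [exact: mp|exact: measurable_cst].
Qed.

Lemma denominator_gt0 (m a u t : R) : m < u -> m <= a -> 0 < t < u / (u - m) ->
  0 < a * t - u * t + u.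
Proof.
move=> mu ma /andP[t0]; rewrite ltr_pdivlMr ?subr_gt0// => tu.
have : m * t <= a * t by rewrite ler_pM2r.
by move: tu; rewrite mulrBr; lra.
Qed.

(** Two pre-optimal proportions [s < t] cannot coexist: the integrand for [t] is
    at most the one for [s], their difference being
    [(t - s) * (a - u) ^+ 2] over the product of the positive denominators. *)
Lemma is_pre_optimal_nlt G u s t : 0 < xi G -> xi G < u ->
  is_pre_optimal G u s -> is_pre_optimal G u t -> ~ (s < t).
Proof.
move=> xi0 xiu [adm_s int_s] [adm_t int_t] st.
have den0 r x : admissible_proportion G u r -> xi G <= profit G x ->
    0 < profit G x * r - u * r + u.
  by move=> adm le; exact: denominator_gt0 xiu le adm.
have cross x : xi G <= profit G x -> excess_ratio G u s x - excess_ratio G u t x =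
    (t - s) * (profit G x - u) ^+ 2 /
      ((profit G x * s - u * s + u) * (profit G x * t - u * t + u)).
  move=> le; rewrite /excess_ratio; field.
  by rewrite !gt_eqF ?den0.
have ae_eq_ts := ae_le_integral_eq0 (measurable_stieltjes_itv _ _)
  (@measurable_excess_ratio G u t) (@measurable_excess_ratio G u s) int_t int_s.
apply: (@profit_not_ae_cst _ G); exists u.
have le_ts : {ae stieltjes (distr G), forall x, [set` domain G] x ->
    excess_ratio G u t x <= excess_ratio G u s x}.
  apply: filterS (xi_le_profit xi0) => x le Dx.
  rewrite -subr_ge0 cross ?le//; apply: divr_ge0; apply: mulr_ge0.
  - by rewrite subr_ge0 ltW.
  - exact: sqr_ge0.
  - by rewrite ltW// den0 ?le.
  - by rewrite ltW// den0 ?le.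
apply: filterS2 (xi_le_profit xi0) (ae_eq_ts le_ts) => x le eq_ts Dx.
apply/eqP; rewrite -subr_eq0 -sqrf_eq0.
have /eqP := cross x (le Dx); rewrite eq_ts// subrr eq_sym.
have dst0 : 0 < (profit G x * s - u * s + u) * (profit G x * t - u * t + u).
  by rewrite mulr_gt0 ?den0 ?le.
by rewrite 2!mulf_eq0 invr_eq0 (gt_eqF dst0) subr_eq0 (gt_eqF st) orbF.
Qed.

Lemma is_pre_optimal_unique G u s t : 0 < xi G -> xi G < u ->
  is_pre_optimal G u s -> is_pre_optimal G u t -> s = t.
Proof.
move=> xi0 xiu ps pt; apply/eqP; rewrite eq_le !leNgt.
apply/andP; split; apply/negP.
  exact: is_pre_optimal_nlt xi0 xiu pt ps.
exact: is_pre_optimal_nlt xi0 xiu ps pt.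
Qed.

(** The equation and the bound on the proportion both scale: the integrand by
    [u / (u + n)] and the bound [u / (u - xi G)] by [(u + n) / u]. *)
Lemma is_pre_optimal_translate G u n t : 0 < xi G -> xi G < u -> - xi G < n ->
  is_pre_optimal (translate G n) (u + n) ((u + n) / u * t) <->
  is_pre_optimal G u t.
Proof.
move=> xi0 xiu nxi.
have u0 : 0 < u by lra.
have un0 : 0 < u + n by lra.
have excessE : excess_ratio (translate G n) (u + n) ((u + n) / u * t) =
    (fun x => u / (u + n) * excess_ratio G u t x).
  apply/funext => x; rewrite /excess_ratio /=.
  set b := profit G x - u.
  have -> : profit G x + n - (u + n) = b by rewrite /b; ring.
  have -> : (profit G x + n) * ((u + n) / u * t) - (u + n) * ((u + n) / u * t)
      + (u + n) = (u + n) / u * (profit G x * t - u * t + u).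
    by field; rewrite gt_eqF.
  by rewrite invfM invf_div mulrCA.
have admE : admissible_proportion (translate G n) (u + n) ((u + n) / u * t) <->
    admissible_proportion G u t.
  rewrite /admissible_proportion xi_translate//.
  have -> : u + n - (xi G + n) = u - xi G by ring.
  rewrite pmulr_rgt0 ?divr_gt0//.
  have -> : (u + n) / (u - xi G) = (u + n) / u * (u / (u - xi G)).
    by rewrite mulrA divfK// gt_eqF.
  by rewrite ltr_pM2l ?divr_gt0.
have mD := measurable_stieltjes_itv (distr G) (domain G).
rewrite /is_pre_optimal admE -!/(excess_ratio _ _ _) /game_integral excessE /=.
split=> -[adm int0]; split => //; last first.
  exact: (integral_scale_eq0 mD _ (@measurable_excess_ratio G u t)).
(* For the converse, the integrand of [G] is recovered by the inverse factor. *)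
have mE := @measurable_excess_ratio (translate G n) (u + n) ((u + n) / u * t).
rewrite excessE in mE.
have := integral_scale_eq0 mD ((u + n) / u) mE int0.
under eq_integral.
  move=> x _; rewrite mulrA -(invf_div u) mulVf ?mul1r; last first.
    by rewrite gt_eqF ?divr_gt0.
  over.
by [].
Qed.

End game.

Theorem theorem2p2 (R : realType) (G : game R) (u : R) :
  0 < xi G ->
  finite_pre_growth G ->
  admissible_price G u ->
  forall n : R, - xi G < n ->
    pre_optimal (translate G n) (u + n) / (u + n) = pre_optimal G u / u.
Proof.
move=> xi0 _ /(xi_lt_price xi0) xiu n nxi.
have u0 : 0 < u by lra.
have un0 : 0 < u + n by lra.
have uneq0 : u != 0 by rewrite gt_eqF.
have unneq0 : u + n != 0 by rewrite gt_eqF.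
have rescale s : s = (u + n) / u * (u / (u + n) * s).
  by field; rewrite uneq0 unneq0.
have [[t pt]|nt] := pselect (exists t, is_pre_optimal G u t).
  have -> : pre_optimal G u = t.
    by apply: get_unique => // s ps; exact: is_pre_optimal_unique ps pt.
  have -> : pre_optimal (translate G n) (u + n) = (u + n) / u * t.
    apply: get_unique => [|s]; first exact/is_pre_optimal_translate.
    rewrite [s]rescale => /is_pre_optimal_translate ps.
    congr (_ * _).
    by apply: is_pre_optimal_unique pt => //; exact: ps.
  by field; rewrite uneq0.
(* Without a solution, [get] returns the default point of [R], which is [0]. *)
have -> : pre_optimal G u = 0.
  by apply: getPN => t pt; apply: nt; exists t.
have -> : pre_optimal (translate G n) (u + n) = 0.
  apply: getPN => s; rewrite [s]rescale => /is_pre_optimal_translate ps.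
  by apply: nt; eexists; exact: ps.
by rewrite !mul0r.
Qed.
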